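(* Let $X, Y$ be (possibly infinite) metric spaces such that $Y$ is a strong scaling limit of $X$. Then there is a strong scaling limit of $(\mathrm{Lip}\,X, d_\infty)$, and it is pseudo-isometric to $(\mathrm{Lip}\,Y, d_\infty)$.
   Context: Let $Z = \mathbb{R}_{\ge 0}\cup\{\infty\}$ with $\infty + z = z+\infty = \infty$ and $z \le \infty$ for all $z\in Z$. A (possibly infinite) metric space is a non-empty set $X$ with a symmetric map $d : X\times X \to Z$ that is positive-definite ($d(x,y)=0$ iff $x=y$) and satisfies the triangle inequality. For $a,b,z \in Z$, $|a-b|\le z$ means $a \le b+z$ and $b \le a+z$; thus $|\infty-\infty| = 0$ and $|\infty - a| = \infty$ for finite $a$. $\mathrm{Lip}\,X$ is the set of all $f: X\to Z$ with $|f(x)-f(y)| \le d(x,y)$ for all $x,y\in X$, with the (possibly infinite) metric $d_\infty(f,g) = \sup_{x\in X}|f(x)-g(x)|$. For real $\epsilon\ge 0$, a (not necessarily continuous) map $\eta : A\to B$ of (possibly infinite) metric spaces is an $\epsilon$-isometric embedding if $|d(a,a') - d(\eta a,\eta a')|\le \epsilon$ for all $a,a'\in A$. An $\epsilon$-isometry is a pair of $\epsilon$-isometric embeddings $\eta:A\to B$, $\eta':B\to A$ with $d(\eta\eta' b,b)\le\epsilon$ for all $b\in B$ and $d(\eta'\eta a,a)\le\epsilon$ for all $a\in A$; $A$ and $B$ are then called $\epsilon$-isometric. The rough distance $d_R(A,B)$ is the infimum of all $\epsilon\ge 0$ such that $A$ and $B$ are $\epsilon$-isometric ($\infty$ if there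 are none). $A$ and $B$ are pseudo-isometric if $d_R(A,B)=0$. For real $\ell>0$, $s_\ell(A,d) = (A,\ell\cdot d)$ with $\ell\cdot\infty=\infty$. A space $B$ is a (strong) scaling limit of $A$ if $d_R(s_\ell A, B)\to 0$ as $\ell\to 0$ (along every sequence of positive $\ell$ tending to $0$); strong scaling limits are considered up to pseudo-isometry. *)

(* Defs.v *)
From mathcomp Require Import all_boot all_order all_algebra.
From mathcomp Require Import all_classical all_reals all_analysis.

Set Implicit Arguments.
Unset Strict Implicit.
Unset Printing Implicit Defensive.

Import Order.TTheory GRing.Theory Num.Theory.
Import numFieldNormedType.Exports.

Local Open Scope classical_set_scope.
Local Open Scope ring_scope.
Local Open Scope ereal_scope.

(* [0, +oo] is represented by the nonnegative elements of \bar R.  On them the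
   library's `|a - b| is the expected distance, except that `|+oo - +oo| = +oo
   there; the test on equality restores the convention |oo - oo| = 0. *)
Definition absdiff (R : realType) (a b : \bar R) : \bar R :=
  if a == b then 0 else `|a - b|.

Lemma absdiff_leP (R : realType) (a b z : \bar R) :
  0 <= a -> 0 <= b -> 0 <= z ->
  absdiff a b <= z <-> a <= b + z /\ b <= a + z.
Proof.
rewrite /absdiff; case: eqP => [<- a0 _ z0|].
  by split=> // _; split; exact: leeDl.
case: a b z => [a| |] [b| |] [z| |] //= neq a0 b0 z0.
all: rewrite -?EFinD ?lee_fin /= ?leey ?leye_eq.
all: try by split=> [|[]].
rewrite ler_norml lerBlDl lerNl opprB lerBlDl.
by split=> [/andP[]|[-> ->]].
Qed.

Lemma absdiff_ge0 (R : realType) (a b : \bar R) : 0 <= absdiff a b.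
Proof. by rewrite /absdiff; case: ifP. Qed.

Lemma absdiffC (R : realType) (a b : \bar R) :
  0 <= a -> 0 <= b -> absdiff a b = absdiff b a.
Proof.
move=> a0 b0; apply/eqP; rewrite eq_le.
have H c e : 0 <= c -> 0 <= e -> absdiff c e <= absdiff e c.
  move=> c0 e0; apply/(absdiff_leP c0 e0 (absdiff_ge0 _ _)).
  by have [] := (absdiff_leP e0 c0 (absdiff_ge0 e c)).1 (lexx _).
by rewrite !H.
Qed.

Lemma absdiff_eq0 (R : realType) (a b : \bar R) :
  0 <= a -> 0 <= b -> absdiff a b = 0 <-> a = b.
Proof.
move=> a0 b0; split=> [ab|->]; last by rewrite /absdiff eqxx.
have [] := (absdiff_leP a0 b0 (absdiff_ge0 a b)).1 (lexx _).
by rewrite ab !adde0 => h1 h2; apply/eqP; rewrite eq_le h1 h2.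
Qed.

Lemma absdiff_triangle (R : realType) (a b c : \bar R) :
  0 <= a -> 0 <= b -> 0 <= c ->
  absdiff a c <= absdiff a b + absdiff b c.
Proof.
move=> a0 b0 c0; set u := absdiff a b; set v := absdiff b c.
have u0 : 0 <= u by exact: absdiff_ge0.
have v0 : 0 <= v by exact: absdiff_ge0.
have [ab ba] := (absdiff_leP a0 b0 u0).1 (lexx _).
have [bc cb] := (absdiff_leP b0 c0 v0).1 (lexx _).
apply/(absdiff_leP a0 c0 (adde_ge0 u0 v0)); split.
- by rewrite (le_trans ab)// (addeC u) addeA leeD2r.
- by rewrite (le_trans cb)// addeA leeD2r.
Qed.

Record xmetric (R : realType) := XMetric {
  xcarrier :> Type;
  xdist : xcarrier -> xcarrier -> \bar R;
  xinhabited : inhabited xcarrier;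
  xdist_ge0 : forall x y, 0 <= xdist x y;
  xdist_sym : forall x y, xdist x y = xdist y x;
  xdist_eq0 : forall x y, xdist x y = 0 <-> x = y;
  xdist_triangle : forall x y z, xdist x z <= xdist x y + xdist y z }.

Definition is_lip (R : realType) (X : xmetric R) (f : X -> \bar R) : Prop :=
  (forall x, 0 <= f x) /\
  (forall x y, absdiff (f x) (f y) <= xdist x y).

Definition lip_carrier (R : realType) (X : xmetric R) : Type :=
  {f : X -> \bar R | is_lip f}.

Definition lip_dist (R : realType) (X : xmetric R) (f g : lip_carrier X) :
    \bar R :=
  ereal_sup [set absdiff (sval f x) (sval g x) | x in [set: X]].

Section lip_metric.
Variables (R : realType) (X : xmetric R).
Implicit Types f g h : lip_carrier X.

Let lip_ge0 f x : 0 <= sval f x. Proof. exact: (svalP f).1. Qed.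

Let lip_dist_ub f g x : absdiff (sval f x) (sval g x) <= lip_dist f g.
Proof. by apply: ereal_sup_ubound; exists x. Qed.

Lemma lip_inhabited : inhabited (lip_carrier X).
Proof.
constructor; exists (fun=> 0); split=> // x y.
by rewrite /absdiff eqxx xdist_ge0.
Qed.

Lemma lip_dist_ge0 f g : 0 <= lip_dist f g.
Proof.
have [x] := xinhabited X.
exact: le_trans (absdiff_ge0 _ _) (lip_dist_ub f g x).
Qed.

Lemma lip_dist_sym f g : lip_dist f g = lip_dist g f.
Proof.
by congr ereal_sup; apply/seteqP; split=> _ [x _ <-]; exists x => //;
  rewrite absdiffC.
Qed.

Lemma lip_dist_eq0 f g : lip_dist f g = 0 <-> f = g.
Proof.
split=> [fg|->].
  apply: eq_sig_hprop => [h|]; first exact: Prop_irrelevance.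
  apply/funext => x; apply/absdiff_eq0 => //.
  by apply/eqP; rewrite eq_le absdiff_ge0 -fg lip_dist_ub.
apply/eqP; rewrite eq_le lip_dist_ge0 andbT.
by apply: ge_ereal_sup => _ [x _ <-]; rewrite /absdiff eqxx.
Qed.

Lemma lip_dist_triangle f g h : lip_dist f h <= lip_dist f g + lip_dist g h.
Proof.
apply: ge_ereal_sup => _ [x _ <-].
apply: le_trans (absdiff_triangle (lip_ge0 f x) (lip_ge0 g x) (lip_ge0 h x)) _.
exact: leeD.
Qed.

Definition Lip : xmetric R :=
  XMetric lip_inhabited lip_dist_ge0 lip_dist_sym lip_dist_eq0
    lip_dist_triangle.

End lip_metric.

Section rescaling.
Variables (R : realType) (l : {posnum R}) (A : xmetric R).

Definition scaled_dist (x y : A) : \bar R := l%:num%:E * xdist x y.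

Lemma scaled_dist_ge0 x y : 0 <= scaled_dist x y.
Proof. by rewrite mule_ge0// xdist_ge0. Qed.

Lemma scaled_dist_sym x y : scaled_dist x y = scaled_dist y x.
Proof. by rewrite /scaled_dist xdist_sym. Qed.

Lemma scaled_dist_eq0 x y : scaled_dist x y = 0 <-> x = y.
Proof.
split=> [/eqP|->].
  by rewrite mule_eq0 eqe gt_eqF//= => /eqP /xdist_eq0.
by rewrite /scaled_dist (xdist_eq0 y y).2 // mule0.
Qed.

Lemma scaled_dist_triangle x y z :
  scaled_dist x z <= scaled_dist x y + scaled_dist y z.
Proof.
rewrite /scaled_dist -ge0_muleDr ?xdist_ge0//.
by apply: lee_wpmul2l => //; exact: xdist_triangle.
Qed.

Definition rescale : xmetric R :=
  XMetric (xinhabited A) scaled_dist_ge0 scaled_dist_sym scaled_dist_eq0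
    scaled_dist_triangle.

End rescaling.

Definition eps_isometric_embedding (R : realType) (eps : R) (A B : xmetric R)
    (eta : A -> B) : Prop :=
  forall a a' : A, absdiff (xdist a a') (xdist (eta a) (eta a')) <= eps%:E.

Definition eps_isometry (R : realType) (eps : R) (A B : xmetric R)
    (eta : A -> B) (eta' : B -> A) : Prop :=
  [/\ eps_isometric_embedding eps eta,
      eps_isometric_embedding eps eta',
      forall b : B, xdist (eta (eta' b)) b <= eps%:E
    & forall a : A, xdist (eta' (eta a)) a <= eps%:E].

Definition eps_isometric (R : realType) (eps : R) (A B : xmetric R) : Prop :=
  exists (eta : A -> B) (eta' : B -> A), eps_isometry eps eta eta'.

(* The infimum of the empty set is +oo in \bar R. *)
Definition rough_dist (R : realType) (A B : xmetric R) : \bar R :=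
  ereal_inf
    [set eps%:E | eps in [set e : R | (0 <= e)%R /\ eps_isometric e A B]].

Definition pseudo_isometric (R : realType) (A B : xmetric R) : Prop :=
  rough_dist A B = 0.

Definition strong_scaling_limit (R : realType) (A B : xmetric R) : Prop :=
  forall l : nat -> {posnum R},
    ((l n)%:num : R)%R @[n --> \oo] --> (0 : R)%R ->
    rough_dist (rescale (l n) A) B @[n --> \oo] --> (0 : \bar R).

(* Main.v *)
Require Import Defs.
From mathcomp Require Import all_boot all_order all_algebra.
From mathcomp Require Import all_classical all_reals all_analysis.

(** The strong scaling limit of Lip X is Lip Y itself, because Lip is
Lipschitz for the rough distance and commutes with rescaling.

If eta : A -> B is an e-isometric embedding and f is in Lip B, then f \o eta
need not be Lipschitz, but it violates the inequality by at most e.  Its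
McShane envelope, a |-> inf_y f (eta y) + d(a, y), is Lipschitz and differs
from f \o eta by at most e everywhere ([lip_envelope_close]).  So the two maps
of an e-isometry between A and B induce maps between Lip B and Lip A that are
precomposition up to an error e, and a few triangle inequalities show that they
form a 4e-isometry ([eps_isometric_Lip]).  Multiplication by l identifies
rescale l (Lip X) with Lip (rescale l X) ([eps_isometric_rescale_Lip]).
Since e-isometries compose ([eps_isometric_trans]), an e-isometry between
rescale l X and Y yields an 8e-isometry between rescale l (Lip X) and Lip Y;
hence Lip Y is a strong scaling limit of Lip X.

Any other strong scaling limit W is pseudo-isometric to Lip Y because, for a
single small l, both are close to the same space rescale l (Lip X)
([strong_scaling_limit_unique]). *)

Set Implicit Arguments.
Unset Strict Implicit.
Unset Printing Implicit Defensive.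

Import Order.TTheory GRing.Theory Num.Theory.
Import numFieldNormedType.Exports.

Local Open Scope classical_set_scope.
Local Open Scope ring_scope.
Local Open Scope ereal_scope.

Section scaling_limit_of_Lip.
Variable R : realType.
Implicit Types (A B C : xmetric R) (e : R).

(** * Distances in [0, +oo] and in Lip *)

Lemma absdiff_le_trans (a b c u v : \bar R) :
  0 <= a -> 0 <= b -> 0 <= c ->
  absdiff a b <= u -> absdiff b c <= v -> absdiff a c <= u + v.
Proof.
move=> a0 b0 c0 ab bc; apply: le_trans (absdiff_triangle a0 b0 c0) _.
exact: leeD.
Qed.

Lemma absdiff_perturb (a a' b b' : \bar R) e :
  0 <= a -> 0 <= a' -> 0 <= b -> 0 <= b' ->
  absdiff a a' <= e%:E -> absdiff b b' <= e%:E ->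
  absdiff a b <= absdiff a' b' + (e *+ 2)%:E.
Proof.
move=> a0 a'0 b0 b'0 aa' bb'; rewrite absdiffC// in bb'.
have aa'b' := absdiff_le_trans a0 a'0 b'0 aa' (lexx _).
apply: le_trans (absdiff_le_trans a0 b'0 b0 aa'b' bb') _.
by rewrite mulr2n EFinD (addeC e%:E) addeA.
Qed.

Lemma lip_val_ge0 A (f : Lip A) x : 0 <= sval f x.
Proof. exact: (svalP f).1. Qed.

Lemma absdiff_lip_dist A (f g : Lip A) x :
  absdiff (sval f x) (sval g x) <= xdist f g.
Proof. by apply: ereal_sup_ubound; exists x. Qed.

Lemma lip_dist_leP A (f g : Lip A) z :
  xdist f g <= z <-> forall x, absdiff (sval f x) (sval g x) <= z.
Proof.
split=> [fgz x|fgz]; first exact: le_trans (absdiff_lip_dist f g x) fgz.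
by apply: ge_ereal_sup => _ [x _ <-].
Qed.

(** * Composition of rough isometries *)

Lemma eps_isometric_ge0 e A B : eps_isometric e A B -> (0 <= e)%R.
Proof.
have [a] := xinhabited A; case=> eta [eta' [H _ _ _]].
by rewrite -lee_fin (le_trans (absdiff_ge0 _ _) (H a a)).
Qed.

Lemma eps_isometric_sym e A B : eps_isometric e A B -> eps_isometric e B A.
Proof. by case=> eta [eta' [? ? ? ?]]; exists eta', eta; split. Qed.

Lemma eps_isometric_le e e' A B : (e <= e')%R ->
  eps_isometric e A B -> eps_isometric e' A B.
Proof.
rewrite -lee_fin => ee' [eta [eta' [H1 H2 H3 H4]]]; exists eta, eta'.
split=> [a a'|b b'|b|a]; apply: le_trans ee'; [exact: H1|exact: H2|..].
- exact: H3.
- exact: H4.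
Qed.

Lemma eps_isometric_embedding_comp e1 e2 A B C (f : A -> B) (g : B -> C) :
  eps_isometric_embedding e1 f -> eps_isometric_embedding e2 g ->
  eps_isometric_embedding (e1 + e2)%R (g \o f).
Proof.
move=> ef eg a a'; rewrite EFinD.
by apply: (absdiff_le_trans _ _ _ (ef a a') (eg _ _)); exact: xdist_ge0.
Qed.

(** The error of g' \o g at f a passes through f', which adds e1 because f'
preserves distances only up to e1; f' \o f adds e1 once more. *)
Lemma eps_isometry_comp_back e1 e2 A B C (f : A -> B) (f' : B -> A)
    (g : B -> C) (g' : C -> B) :
  eps_isometry e1 f f' -> eps_isometry e2 g g' ->
  forall a, xdist (f' (g' (g (f a)))) a <= (e1 + e2 + e1)%:E.
Proof.
move=> If Ig a; have [_ ef' _ f'f] := If; have [_ _ _ g'g] := Ig.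
have e1_ge0 : 0 <= e1%:E.
  by rewrite lee_fin; apply: (@eps_isometric_ge0 _ A B); exists f, f'.
have [_] := (absdiff_leP (xdist_ge0 _ _) (xdist_ge0 _ _) e1_ge0).1
              (ef' (g' (g (f a))) (f a)).
move=> f'_close; apply: le_trans (xdist_triangle _ (f' (f a)) _) _.
rewrite !EFinD; apply: leeD; last exact: f'f.
by apply: le_trans f'_close _; rewrite addeC leeD2r.
Qed.

Lemma eps_isometric_trans e1 e2 A B C :
  eps_isometric e1 A B -> eps_isometric e2 B C ->
  eps_isometric ((e1 + e2) *+ 2)%R A C.
Proof.
move=> AB BC; have e1_ge0 := eps_isometric_ge0 AB.
have e2_ge0 := eps_isometric_ge0 BC.
case: AB BC => f [f' If] [g [g' Ig]]; exists (g \o f), (f' \o g').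
have [ef ef' ff' f'f] := If; have [eg eg' gg' g'g] := Ig.
have le1 : (e1 + e2 <= (e1 + e2) *+ 2)%R by rewrite mulr2n lerDl addr_ge0.
split=> [a a'|c c'|c|a].
- apply: le_trans (eps_isometric_embedding_comp ef eg a a') _.
  by rewrite lee_fin.
- apply: le_trans (eps_isometric_embedding_comp eg' ef' c c') _.
  by rewrite addrC lee_fin.
- have Ig' : eps_isometry e2 g' g by split.
  have If' : eps_isometry e1 f' f by split.
  apply: le_trans (eps_isometry_comp_back Ig' If' c) _.
  by rewrite lee_fin mulr2n (addrC e2) lerD2l lerDr.
- apply: le_trans (eps_isometry_comp_back If Ig a) _.
  by rewrite lee_fin mulr2n lerD2l lerDl.
Qed.

(** * The Lipschitz envelope *)

(** McShane's construction: for g >= 0, the largest 1-Lipschitz function below g. *)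
Definition lip_envelope A (g : A -> \bar R) (x : A) : \bar R :=
  ereal_inf [set g y + xdist x y | y in [set: A]].

Lemma lip_envelope_le A (g : A -> \bar R) x y :
  lip_envelope g x <= g y + xdist x y.
Proof. by apply: ereal_inf_lbound; exists y. Qed.

Lemma lip_envelope_ge0 A (g : A -> \bar R) x :
  (forall y, 0 <= g y) -> 0 <= lip_envelope g x.
Proof.
by move=> g0; apply: le_ereal_inf_tmp => _ [y _ <-]; rewrite adde_ge0 ?xdist_ge0.
Qed.

Lemma lip_envelope_le_dist A (g : A -> \bar R) : (forall y, 0 <= g y) ->
  forall x y, lip_envelope g x <= lip_envelope g y + xdist x y.
Proof.
move=> g0 x y; case dxy: (xdist x y) (xdist_ge0 x y) => [r| |] // _.
  (* The finite r is subtracted, so that each term of the infimum defining the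
     envelope at y can be treated separately. *)
  rewrite -leeBlDr//; apply: le_ereal_inf_tmp => _ [z _ <-].
  rewrite leeBlDr//; apply: le_trans (lip_envelope_le g x z) _.
  by rewrite -addeA leeD2l// addeC -dxy xdist_triangle.
by rewrite addey ?leey// -ltNye (lt_le_trans _ (lip_envelope_ge0 y g0)).
Qed.

Lemma is_lip_envelope A (g : A -> \bar R) :
  (forall y, 0 <= g y) -> is_lip (lip_envelope g).
Proof.
move=> g0; split=> [x|x y]; first exact: lip_envelope_ge0.
apply/absdiff_leP; rewrite ?lip_envelope_ge0 ?xdist_ge0//.
by split; [|rewrite xdist_sym]; exact: lip_envelope_le_dist.
Qed.

(** The envelope cannot exceed g, by the choice y = x, and it falls below g by
at most the defect e of the Lipschitz inequality. *)
Lemma lip_envelope_close A (g : A -> \bar R) e :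
  (forall y, 0 <= g y) -> (0 <= e)%R ->
  (forall x y, g x <= g y + (xdist x y + e%:E)) ->
  forall x, absdiff (lip_envelope g x) (g x) <= e%:E.
Proof.
move=> g0 e0 ge x; apply/absdiff_leP; rewrite ?lip_envelope_ge0 ?lee_fin//.
split.
  apply: le_trans (lip_envelope_le g x x) _.
  by rewrite (xdist_eq0 x x).2// leeD2l ?lee_fin.
rewrite -leeBlDr//; apply: le_ereal_inf_tmp => _ [y _ <-].
by rewrite leeBlDr// -addeA ge.
Qed.

(** * Functoriality of Lip for rough isometries *)

(** The Lipschitz replacement for f \o eta, which is Lipschitz only up to an
error when eta is a rough isometric embedding. *)
Definition lip_pullback A B (eta : A -> B) (f : Lip B) : Lip A :=
  exist _ _ (is_lip_envelope (fun a => lip_val_ge0 f (eta a))).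

Lemma lip_pullback_close e A B (eta : A -> B) : (0 <= e)%R ->
  eps_isometric_embedding e eta -> forall (f : Lip B) a,
  absdiff (sval (lip_pullback eta f) a) (sval f (eta a)) <= e%:E.
Proof.
move=> e0 eeta f a; apply: lip_envelope_close => // [x|x y].
  exact: lip_val_ge0.
have [+ _] := (absdiff_leP (lip_val_ge0 f _) (lip_val_ge0 f _)
  (xdist_ge0 _ _)).1 ((svalP f).2 (eta x) (eta y)).
move=> /le_trans; apply; rewrite leeD2l//.
have e0' : 0 <= e%:E by rewrite lee_fin.
by have [] := (absdiff_leP (xdist_ge0 _ _) (xdist_ge0 _ _) e0').1 (eeta x y).
Qed.

(** The values of [lip_pullback eta f] are close to those of f on the image of
eta.  This image is e-dense, so no more than a bounded multiple of e is lost
when the supremum that defines the distance in Lip B is compared with the one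
in Lip A. *)
Lemma lip_pullback_embedding e A B (eta : A -> B) (eta' : B -> A) :
  (0 <= e)%R -> eps_isometric_embedding e eta ->
  (forall b, xdist (eta (eta' b)) b <= e%:E) ->
  eps_isometric_embedding (e *+ 4)%R (lip_pullback eta).
Proof.
move=> e0 eeta etaK f g.
have close := lip_pullback_close e0 eeta.
have far (h : Lip B) b :
    absdiff (sval h b) (sval (lip_pullback eta h) (eta' b)) <= (e *+ 2)%:E.
  (* Through the value of h at eta (eta' b). *)
  rewrite absdiffC ?lip_val_ge0// mulr2n EFinD.
  apply: (absdiff_le_trans _ _ _ (close h (eta' b))); rewrite ?lip_val_ge0//.
  by apply: le_trans ((svalP h).2 _ _) _.
apply/absdiff_leP; rewrite ?xdist_ge0 ?lee_fin ?mulrn_wge0//.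
split; apply/lip_dist_leP => x.
- have := absdiff_perturb _ _ _ _ (far f x) (far g x).
  rewrite !lip_val_ge0 -mulrnA => /(_ isT isT isT isT)/le_trans; apply.
  by rewrite leeD2r// absdiff_lip_dist.
- have := absdiff_perturb _ _ _ _ (close f x) (close g x).
  rewrite !lip_val_ge0 => /(_ isT isT isT isT)/le_trans; apply.
  by rewrite leeD ?absdiff_lip_dist// lee_fin ler_wpMn2l.
Qed.

Lemma lip_pullbackK e A B (eta : A -> B) (eta' : B -> A) :
  eps_isometry e eta eta' -> forall f : Lip B,
  xdist (lip_pullback eta' (lip_pullback eta f)) f <= (e *+ 4)%:E.
Proof.
move=> I f; have [eeta eeta' etaK _] := I.
have e0 : (0 <= e)%R by apply: (@eps_isometric_ge0 _ A B); exists eta, eta'.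
apply/lip_dist_leP => b.
have := absdiff_le_trans (lip_val_ge0 _ _) (lip_val_ge0 _ _)
  (lip_val_ge0 f _) (lip_pullback_close e0 eeta' (lip_pullback eta f) b)
  (lip_pullback_close e0 eeta f _).
move=> /(absdiff_le_trans (lip_val_ge0 _ _) (lip_val_ge0 _ _)
  (lip_val_ge0 f b))/(_ (le_trans ((svalP f).2 _ b) (etaK b))).
move=> /le_trans; apply; rewrite -!EFinD lee_fin -mulr2n -mulrSr.
by rewrite ler_wpMn2l.
Qed.

Lemma eps_isometric_Lip e A B :
  eps_isometric e A B -> eps_isometric (e *+ 4)%R (Lip A) (Lip B).
Proof.
move=> AB; have e0 := eps_isometric_ge0 AB.
have [eta [eta' I]] := AB; have [eeta eeta' etaK eta'K] := I.
have I' : eps_isometry e eta' eta by split.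
exists (lip_pullback eta'), (lip_pullback eta); split.
- exact: lip_pullback_embedding eta'K.
- exact: lip_pullback_embedding etaK.
- exact: lip_pullbackK.
- exact: lip_pullbackK.
Qed.

(** * Lip commutes with rescaling *)

Lemma muleKV (k : R) (x : \bar R) : (k != 0)%R -> k^-1%:E * (k%:E * x) = x.
Proof. by move=> k0; rewrite muleA -EFinM mulVf// mul1e. Qed.

Lemma absdiffZ (k : R) (a b : \bar R) : (0 < k)%R -> 0 <= a -> 0 <= b ->
  absdiff (k%:E * a) (k%:E * b) = k%:E * absdiff a b.
Proof.
move=> k0 a0 b0; rewrite /absdiff.
have -> : (k%:E * a == k%:E * b) = (a == b).
  apply/eqP/eqP => [kab|->//].
  by rewrite -(muleKV a (lt0r_neq0 k0)) kab muleKV// gt_eqF.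
case: eqP => [_|ab]; first by rewrite mule0.
rewrite -muleBr// ?abseM ?(@gee0_abs _ k%:E) ?lee_fin ?(ltW k0)//.
by case: a b ab a0 b0 => [a| |] [b| |] // [].
Qed.

Lemma eps_isometric0 A B (f : A -> B) (f' : B -> A) :
  cancel f f' -> cancel f' f ->
  (forall x y, xdist (f x) (f y) = xdist x y) -> eps_isometric 0%R A B.
Proof.
move=> fK f'K fE; exists f, f'.
have absdiffxx (a : \bar R) : absdiff a a = 0 by rewrite /absdiff eqxx.
split=> [a a'|b b'|b|a].
- by rewrite fE absdiffxx.
- by rewrite -fE !f'K absdiffxx.
- by rewrite f'K (xdist_eq0 b b).2.
- by rewrite fK (xdist_eq0 a a).2.
Qed.

Section scaling.
Variables (l : {posnum R}) (A : xmetric R).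

Lemma is_lip_scale (f : Lip A) :
  is_lip (X := rescale l A) (fun x => l%:num%:E * sval f x).
Proof.
split=> [x|x y]; first by rewrite mule_ge0// lip_val_ge0.
by rewrite absdiffZ ?lip_val_ge0// lee_wpmul2l//; exact: (svalP f).2.
Qed.

Lemma is_lip_unscale (f : Lip (rescale l A)) :
  is_lip (X := A) (fun x => l%:num^-1%:E * sval f x).
Proof.
split=> [x|x y]; first by rewrite mule_ge0 ?lee_fin// lip_val_ge0.
rewrite absdiffZ ?invr_gt0 ?lip_val_ge0// -[leRHS](@muleKV l%:num)//.
by rewrite lee_wpmul2l ?lee_fin//; exact: (svalP f).2.
Qed.

(** Multiplication of values by l turns the Lipschitz functions for d into
those for l * d, with inverse the multiplication by l^-1, and it scales the
supremum distance by l. *)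
Lemma eps_isometric_rescale_Lip :
  eps_isometric 0%R (rescale l (Lip A)) (Lip (rescale l A)).
Proof.
pose up (f : rescale l (Lip A)) : Lip (rescale l A) :=
  exist _ _ (is_lip_scale f).
pose down (f : Lip (rescale l A)) : rescale l (Lip A) :=
  exist _ _ (is_lip_unscale f).
apply: (@eps_isometric0 _ _ up down) => [f|f|f g].
- apply: eq_sig_hprop => [h|]; first exact: Prop_irrelevance.
  by apply/funext => x /=; rewrite muleKV.
- apply: eq_sig_hprop => [h|]; first exact: Prop_irrelevance.
  by apply/funext => x /=; rewrite muleA -EFinM divff// mul1e.
- rewrite /= /scaled_dist /= /lip_dist -ereal_sup_pZl// image_comp.
  congr ereal_sup; apply: eq_imagel => x _ /=.
  by rewrite absdiffZ//; exact: lip_val_ge0.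
Qed.

End scaling.

(** * Strong scaling limits *)

Lemma rough_dist_ge0 A B : 0 <= rough_dist A B.
Proof. by apply: le_ereal_inf_tmp => _ [e [e0 _] <-]; rewrite lee_fin. Qed.

Lemma rough_dist_le e A B : eps_isometric e A B -> rough_dist A B <= e%:E.
Proof.
by move=> AB; apply: ereal_inf_lbound; exists e => //; split=> //;
  exact: eps_isometric_ge0 AB.
Qed.

Lemma rough_dist_lt e A B : rough_dist A B < e%:E -> eps_isometric e A B.
Proof.
move=> /ereal_inf_lt [_ [d [_ AB] <-]]; rewrite lte_fin => /ltW de.
exact: eps_isometric_le de AB.
Qed.

Lemma pseudo_isometricP A B :
  (forall e, (0 < e)%R -> eps_isometric e A B) -> pseudo_isometric A B.
Proof.
move=> AB; apply/eqP; rewrite eq_le rough_dist_ge0 andbT.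
by apply/lee_addgt0Pr => e e0; rewrite add0e; exact: rough_dist_le (AB e e0).
Qed.

Lemma rough_dist_cvg0P (A : nat -> xmetric R) B :
  rough_dist (A n) B @[n --> \oo] --> (0 : \bar R) <->
  forall e, (0 < e)%R -> \forall n \near \oo, eps_isometric e (A n) B.
Proof.
split=> [AB e e0|AB].
  near=> n; apply: rough_dist_lt; near: n.
  exact: (AB _ (@nbhs_open_ereal_lt _ 0%R (fun=> e) e0)).
apply/fine_cvgP; split.
  near=> n; rewrite ge0_fin_numE ?rough_dist_ge0//.
  apply: (@le_lt_trans _ _ 1%:E); rewrite ?ltry//.
  by apply: rough_dist_le; near: n; exact: AB.
apply/cvgr0Pnorm_le => e e0; near=> n => /=.
have le_e : rough_dist (A n) B <= e%:E.
  by apply: rough_dist_le; near: n; exact: AB.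
have d0 := rough_dist_ge0 (A n) B.
rewrite ger0_norm ?fine_ge0// -lee_fin fineK// ge0_fin_numE//.
exact: le_lt_trans le_e (ltry _).
Unshelve. all: by end_near. Qed.

(** The factor 8 is 4 from [eps_isometric_Lip] times 2 from the composition
with the exact isometry [eps_isometric_rescale_Lip]. *)
Lemma strong_scaling_limit_Lip A B :
  strong_scaling_limit A B -> strong_scaling_limit (Lip A) (Lip B).
Proof.
move=> AB l l0; apply/rough_dist_cvg0P => e e0.
have e8_gt0 : (0 < e / 8)%R by rewrite divr_gt0.
have /rough_dist_cvg0P/(_ _ e8_gt0) := AB l l0; apply: filterS => n ABn.
have -> : e = ((0 + e / 8 *+ 4) *+ 2)%R.
  by rewrite add0r -mulrnA -[RHS]mulr_natr divfK.
exact: eps_isometric_trans (eps_isometric_rescale_Lip _ _)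
  (eps_isometric_Lip ABn).
Qed.

(** Both B and C are (e / 4)-isometric to A rescaled by 1 / n.+1 for the same
large n, hence e-isometric to each other. *)
Lemma strong_scaling_limit_unique A B C :
  strong_scaling_limit A B -> strong_scaling_limit A C -> pseudo_isometric B C.
Proof.
move=> AB AC; apply: pseudo_isometricP => e e0.
have e4_gt0 : (0 < e / 4)%R by rewrite divr_gt0.
pose l n : {posnum R} := PosNum (harmonic_gt0 n).
have l0 : ((l n)%:num : R)%R @[n --> \oo] --> (0 : R)%R by exact: cvg_harmonic.
have /rough_dist_cvg0P/(_ _ e4_gt0) ABe := AB l l0.
have /rough_dist_cvg0P/(_ _ e4_gt0) ACe := AC l l0.
have [n [ABn ACn]] := filter_ex (filterI ABe ACe).
have -> : e = ((e / 4 + e / 4) *+ 2)%R.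
  by rewrite -mulr2n -mulrnA -[RHS]mulr_natr divfK.
exact: eps_isometric_trans (eps_isometric_sym ABn) ACn.
Qed.

End scaling_limit_of_Lip.

Theorem corollary35 (R : realType) (X Y : xmetric R)
    (hXY : strong_scaling_limit X Y) :
  (exists W : xmetric R, strong_scaling_limit (Lip X) W) /\
  (forall W : xmetric R,
     strong_scaling_limit (Lip X) W -> pseudo_isometric W (Lip Y)).
Proof.
have limLip := strong_scaling_limit_Lip hXY.
split=> [|W limW]; first by exists (Lip Y).
exact: strong_scaling_limit_unique limW limLip.
Qed.
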